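(* Let $G$ be a graph of order $n$ with girth $g(G)=4$. Then $IC(G)=n$ if and only if $G\in\{C_4,\mathcal{K}_0\}\cup\mathcal{K}$ (up to isomorphism).
   Context: Graphs are finite and simple. The girth $g(G)$ of a graph with a cycle is the length of its shortest cycle. $C_4$ is the cycle of order 4. For vertex sets $X,Y$, $[X,Y]$ is full if every vertex of $X$ is adjacent to every vertex of $Y$, and empty if there are no edges between $X$ and $Y$. $\mathcal{K}_0$ is the bipartite graph with partite sets $H_1=\{v_1,v_2,v_3,v_4\}$ and $H_2=\{u_1,u_2,u_3,u_4\}$ in which, for each $1\le i\le 4$, $v_i$ is adjacent to all vertices of $H_2$ except $u_i$. $\mathcal{K}$ is the family of $4$-partite graphs with partite (independent) sets $H_1=\{v_1,v_2,v_3,v_4\}$, $H_2=\{u_1,u_2,u_3,u_4\}$, $H_3=\{n_1,\dots,n_k\}$, $H_4=\{m_1,\dots,m_k\}$, for $k\ge 1$, such that: $[H_1,H_3]$ and $[H_2,H_4]$ are full; $[H_1,H_4]$ and $[H_2,H_3]$ are empty; for each $1\le i\le 4$, $v_i$ is adjacent to all vertices of $H_2$ except $u_i$; for each $1\le i\le k$, $n_i$ is adjacent to all vertices of $H_4$ except $m_i$. A set $S$ of vertices is dominating if every vertex is in $S$ or adjacent to a vertex of $S$; it is independent if its vertices are pairwise nonadjacent; an independent dominating set is a set that is both independent and dominating. An independent coalition in $G$ consists of two disjoint independent sets of vertices $V_1,V_2$, neither of which is an independent dominating set but whose union $V_1\cup V_2$ is an independent dominating set; one says that $V_1$ and $V_2$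 form an independent coalition. An $ic$-partition of $G$ is a partition $\pi=\{V_1,\dots,V_k\}$ of $V(G)$ into nonempty sets such that every $V_i\in\pi$ either is a singleton dominating set (a dominating set of cardinality 1), or is not an independent dominating set but forms an independent coalition with another set $V_j\in\pi$. The independent coalition number $IC(G)$ is the maximum number of classes of an $ic$-partition of $G$; the assertion $IC(G)=t$ includes that $G$ has an $ic$-partition. *)

(* Defs.v *)
From HB Require Import structures.
From mathcomp Require Import all_boot.

Set Implicit Arguments.
Unset Strict Implicit.
Unset Printing Implicit Defensive.

Record sgraph := SGraph {
  svertex :> finType;
  sedge : rel svertex;
  sedge_sym : symmetric sedge;
  sedge_irr : irreflexive sedge }.

Definition isomorphic (G H : sgraph) : Prop :=
  exists2 f : G -> H, bijective f &
    forall x y : G, sedge (f x) (f y) = sedge x y.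

(* [path.cycle] accepts closed walks of any length; hence [uniq] and the
   lower bound on the length. *)
Definition simple_cycle (G : sgraph) (c : seq G) : bool :=
  [&& cycle (@sedge G) c, uniq c & 2 < size c].

(* Relational, so that it holds for no [g] when G is acyclic. *)
Definition is_girth (G : sgraph) (g : nat) : Prop :=
  (exists2 c : seq G, simple_cycle c & size c = g) /\
  (forall c : seq G, simple_cycle c -> g <= size c).

Section IndependentCoalitions.
Variable G : sgraph.
Implicit Types (S V W : {set G}) (P : {set {set G}}).

Definition dominating S : bool :=
  [forall x, (x \in S) || [exists y in S, sedge x y]].

Definition independent S : bool :=
  [forall x in S, forall y in S, ~~ sedge x y].

Definition ind_dominating S : bool := independent S && dominating S.

Definition ind_coalition V W : bool :=
  [&& [disjoint V & W], independent V, independent W,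
      ~~ ind_dominating V, ~~ ind_dominating W & ind_dominating (V :|: W)].

(* MathComp's [partition] already requires the classes to be nonempty. *)
Definition ic_partition P : bool :=
  partition P [set: G] &&
  [forall V in P,
     ((#|V| == 1) && dominating V) ||
     (~~ ind_dominating V && [exists W in P :\ V, ind_coalition V W])].

End IndependentCoalitions.

(* Relational, so that it holds for no [t] when G has no ic-partition. *)
Definition is_IC (G : sgraph) (t : nat) : Prop :=
  (exists2 P : {set {set G}}, ic_partition P & #|P| = t) /\
  (forall P : {set {set G}}, ic_partition P -> #|P| <= t).

Definition C4_rel : rel 'I_4 :=
  fun i j => (j == i.+1 %% 4 :> nat) || (i == j.+1 %% 4 :> nat).

Lemma C4_sym : symmetric C4_rel.
Proof. by move=> i j; rewrite /C4_rel orbC. Qed.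

Lemma C4_irr : irreflexive C4_rel.
Proof. by case; do 4?[case=> //]. Qed.

Definition C4 : sgraph := SGraph C4_sym C4_irr.

(* [inl i] is v_i and [inr j] is u_j. *)
Definition K0_rel : rel ('I_4 + 'I_4) := fun x y =>
  match x, y with
  | inl i, inr j | inr j, inl i => i != j
  | _, _ => false
  end.

Lemma K0_sym : symmetric K0_rel.
Proof. by case=> i [] j. Qed.

Lemma K0_irr : irreflexive K0_rel.
Proof. by case. Qed.

Definition K0 : sgraph := SGraph K0_sym K0_irr.

(* H1, H2, H3, H4 are, in this order, the images of the 'I_4's and 'I_k's:
   v_i = inl (inl i), u_i = inl (inr i), n_i = inr (inl i), m_i = inr (inr i). *)
Definition K_rel (k : nat) : rel (('I_4 + 'I_4) + ('I_k + 'I_k)) := fun x y =>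
  match x, y with
  | inl (inl i), inl (inr j) | inl (inr j), inl (inl i) => i != j
  | inr (inl i), inr (inr j) | inr (inr j), inr (inl i) => i != j
  | inl (inl _), inr (inl _) | inr (inl _), inl (inl _) => true
  | inl (inr _), inr (inr _) | inr (inr _), inl (inr _) => true
  | _, _ => false
  end.

Lemma K_sym (k : nat) : symmetric (@K_rel k).
Proof. by case=> [] [] i [] [] j. Qed.

Lemma K_irr (k : nat) : irreflexive (@K_rel k).
Proof. by case=> [] []. Qed.

Definition K (k : nat) : sgraph := SGraph (@K_sym k) (@K_irr k).

(* Main.v *)
Require Import Defs.
From mathcomp Require Import all_boot.

Set Implicit Arguments.
Unset Strict Implicit.
Unset Printing Implicit Defensive.

(** A partition into [#|G|] classes is the partition into singletons, so
    [IC(G) = n] says that every non-universal vertex [x] has a partner: a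
    nonadjacent [y] such that each other vertex is adjacent to [x] or [y]
    ([is_IC_orderP]).  Girth 4 means that [G] is triangle-free and contains a
    square, so no vertex is universal and every vertex has a partner.

    The graphs to be found are [C4] and the crowns, that is, [K_(m,m)] minus a
    perfect matching, with [m >= 4]: [K0] is the crown on 8 vertices, and [K k]
    the crown with sides [H1 U H4] and [H2 U H3] of size [4 + k].  Two crowns of
    the same order are isomorphic ([crown_isomorphic]), so only the crown
    structure has to be recognised.

    Suppose that partners [v], [w] have a common neighbour [c].  By
    triangle-freeness [v] and [w] are the only neighbours of [c], so the
    partner of [c] is adjacent to all remaining vertices.  If it is adjacent to
    both [v] and [w], then [G] is [C4]; if to only one of them, then [G] is a
    5-cycle with one vertex replaced by a set of twins, and the partner
    condition at a twin allows at most one of them, so that there is no square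
    ([common_neighbour_C4]).

    If instead partners never have a common neighbour, the neighbourhoods of a
    pair [v], [w] split the other vertices into two independent sets, so [G] is
    bipartite.  Partners on the same side would exhaust that side and share a
    neighbour on the square; hence they lie on opposite sides and, each being
    adjacent to everything else there, [G] is a crown ([disjoint_crown]).  A
    square has two vertices on each side, and these are distinct from the
    partners of the other two, so the sides have at least 4 vertices. *)

(** * Partners and singleton partitions *)

Definition partner (G : sgraph) (x y : G) : bool :=
  [&& x != y, ~~ sedge x y &
      [forall z, [|| z == x, z == y, sedge x z | sedge y z]]].

Definition paired (G : sgraph) : Prop := forall x : G, exists y, partner x y.

Lemma partnerP (G : sgraph) (x y : G) :
  reflect [/\ x != y, ~~ sedge x y &
              forall z, z != x -> z != y -> sedge x z || sedge y z]
          (partner x y).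
Proof.
apply: (iffP and3P) => -[xy nxy H]; split=> //.
  move=> z zx zy; have := forallP H z.
  by rewrite (negPf zx) (negPf zy).
by apply/forallP=> z; case: eqVneq => //= zx; case: eqVneq => //= zy; apply: H.
Qed.

Lemma partner_sym (G : sgraph) : symmetric (@partner G).
Proof.
have imp (x y : G) : partner x y -> partner y x.
  case/partnerP=> xy nxy H; apply/partnerP; split.
  - by rewrite eq_sym.
  - by rewrite sedge_sym.
  - by move=> z zy zx; rewrite orbC H.
by move=> x y; apply/idP/idP; apply: imp.
Qed.

Lemma independent1 (G : sgraph) (x : G) : independent [set x].
Proof.
apply/forall_inP=> y /set1P->; apply/forall_inP=> z /set1P->.
by rewrite sedge_irr.
Qed.

Lemma dominating1P (G : sgraph) (x : G) :
  reflect (forall z, z != x -> sedge x z) (dominating [set x]).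
Proof.
apply: (iffP forallP) => H z.
  move=> zx; have := H z; rewrite inE (negPf zx) /=.
  by case/exists_inP=> y /set1P->; rewrite sedge_sym.
rewrite inE; case: eqVneq => //= zx.
by apply/exists_inP; exists x; rewrite ?inE // sedge_sym H.
Qed.

Lemma ind_coalition_set1 (G : sgraph) (x y : G) :
  ind_coalition [set x] [set y] = partner x y.
Proof.
apply/idP/partnerP.
  case/and5P=> dxy _ _ _ /andP[_ /andP[ixy dom]].
  have xy : x != y by move: dxy; rewrite disjoints1 inE.
  split=> // [|z zx zy].
    have /forall_inP/(_ x (set21 x y)) := ixy.
    by move/forall_inP/(_ y (set22 x y)).
  have := forallP dom z; rewrite !inE (negPf zx) (negPf zy) /=.
  case/exists_inP=> t; rewrite !inE => /orP[]/eqP->; rewrite sedge_sym => ->//.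
  by rewrite orbT.
case=> xy nxy H; have nyx : ~~ sedge y x by rewrite sedge_sym.
rewrite /ind_coalition disjoints1 inE xy !independent1 /=.
apply/and3P; split.
- apply/negP=> /andP[_ /dominating1P/(_ y)]; rewrite (negPf nxy) eq_sym.
  by move/(_ xy).
- by apply/negP=> /andP[_ /dominating1P/(_ x xy)]; rewrite (negPf nyx).
apply/andP; split.
  by apply/forall_inP=> s /set2P[]->; apply/forall_inP=> t /set2P[]->;
    rewrite ?sedge_irr.
apply/forallP=> z; rewrite !inE.
case: eqVneq => //= zx; case: eqVneq => //= zy.
have /orP[e|e] := H z zx zy; apply/exists_inP.
  by exists x; rewrite ?inE ?eqxx // sedge_sym.
by exists y; rewrite ?inE ?eqxx ?orbT // sedge_sym.
Qed.

Definition singletons (T : finType) : {set {set T}} := [set [set x] | x in T].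

Lemma partition_singletons (T : finType) : partition (singletons T) [set: T].
Proof.
apply/and3P; split.
- apply/eqP/setP=> x; rewrite inE; apply/bigcupP.
  by exists [set x]; rewrite ?inE // imset_f.
- apply/trivIsetP=> _ _ /imsetP[x _ ->] /imsetP[y _ ->] xy.
  by rewrite disjoints1 inE; apply: contraNneq xy => ->.
- by apply/imsetP=> -[x _ /setP/(_ x)]; rewrite !inE eqxx.
Qed.

Lemma card_singletons (T : finType) : #|singletons T| = #|T|.
Proof. by rewrite card_imset //; apply: set1_inj. Qed.

(** The number of elements is the sum of the class sizes, each at least 1. *)
Lemma partition_card_leqif (T : finType) (P : {set {set T}}) :
  partition P [set: T] ->
  #|P| <= #|T| ?= iff [forall A in P, #|A| == 1].
Proof.
move=> partP; rewrite -cardsT (card_partition partP) -sum1_card.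
have H := @leqif_sum _ (mem P) (fun A : {set T} => #|A| == 1)
  (fun=> 1) (fun A : {set T} => #|A|).
apply: H => A AP; split; last by rewrite eq_sym.
rewrite card_gt0; apply: contraTneq AP => ->.
by case/and3P: partP.
Qed.

Lemma partition_card_max (T : finType) (P : {set {set T}}) :
  partition P [set: T] -> #|P| = #|T| -> P = singletons T.
Proof.
move=> partP cP.
have single A : A \in P -> #|A| == 1.
  by have [_] := partition_card_leqif partP; rewrite cP eqxx => /esym/forall_inP; apply.
have sub : P \subset singletons T.
  by apply/subsetP=> A /single/cards1P[x ->]; apply: imset_f.
by apply/eqP; rewrite eqEcard sub card_singletons cP leqnn.
Qed.

Lemma is_IC_orderP (G : sgraph) :
  is_IC G #|G| <->
  (forall x : G, dominating [set x] \/ exists y, partner x y).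
Proof.
split=> [[[P /andP[partP icP] cP] _] x | H].
  rewrite {partP cP}(partition_card_max partP cP) in icP.
  have /(forall_inP icP) : [set x] \in singletons G by apply: imset_f.
  case/orP=> [/andP[_ ?]|/andP[_ /exists_inP[W]]]; first by left.
  case/setD1P=> _ /imsetP[y _ ->]; rewrite ind_coalition_set1.
  by right; exists y.
split; last first.
  by move=> P /andP[/partition_card_leqif[]].
exists (singletons G); last exact: card_singletons.
rewrite /ic_partition partition_singletons /=.
apply/forall_inP=> _ /imsetP[x _ ->]; rewrite cards1 eqxx /=.
have [//|[y xy]] := H x; first by move->.
apply/orP; right; have := xy; rewrite -ind_coalition_set1 => co.
case/and5P: (co) => _ _ _ -> _ /=.
apply/exists_inP; exists [set y] => //.
rewrite !inE imset_f // andbT; case/partnerP: xy => xy _ _.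
by apply: contra xy => /eqP/set1_inj->.
Qed.

(** * Isomorphisms and crowns *)

Lemma isomorphic_sym (G H : sgraph) : isomorphic G H -> isomorphic H G.
Proof.
case=> f [g fK gK] fe; exists g; first by exists f.
by move=> x y; rewrite -fe !gK.
Qed.

Lemma isomorphic_paired (G H : sgraph) : isomorphic G H -> paired H -> paired G.
Proof.
case=> f [g fK gK] fe pH x; have [y /partnerP[xy nxy dom]] := pH (f x).
have neq_f z t : z != g t -> f z != t by apply: contra => /eqP<-; rewrite fK.
exists (g y); apply/partnerP; split=> [||z zx zy].
- by apply: contra xy => /eqP->; rewrite gK.
- by rewrite -fe gK.
- rewrite -!(fe _ z) gK; apply: dom; last exact: neq_f.
  by rewrite (inj_eq (can_inj fK)).
Qed.

(** [s] tells the side of a vertex, and [p] is the perfect matching removed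
    from the complete bipartite graph between the two sides. *)
Definition crown (G : sgraph) (s : G -> bool) (p : G -> G) : Prop :=
  [/\ involutive p, forall x, s (p x) = ~~ s x &
      forall x y, sedge x y = (s x != s y) && (y != p x)].

Lemma crown_paired (G : sgraph) (s : G -> bool) (p : G -> G) :
  crown s p -> paired G.
Proof.
case=> pK sp eE x; exists (p x); apply/partnerP; split.
- by apply/eqP=> xE; have := sp x; rewrite -xE; case: (s x).
- by rewrite eE eqxx andbF.
- by move=> z zx zp; rewrite !eE pK zx zp sp; case: (s x) (s z) => [] [].
Qed.

(** The matching exchanges the two sides. *)
Lemma crown_card (G : sgraph) (s : G -> bool) (p : G -> G) :
  crown s p -> #|G| = #|[set x | s x]|.*2.
Proof.
case=> pK sp _; rewrite -(cardsC [set x | s x]) -addnn; congr (_ + _).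
have <- : p @: [set x | s x] = ~: [set x | s x].
  apply/setP=> x; rewrite !inE; apply/imsetP/idP => [[y + ->]|nsx].
    by rewrite inE sp => ->.
  by exists (p x); rewrite ?pK // inE sp.
by rewrite card_imset //; apply: inv_inj.
Qed.

Lemma leq_card_injection (T U : finType) (A : {set T}) (B : {set U}) :
  0 < #|B| -> #|A| <= #|B| ->
  exists2 f : T -> U, {in A &, injective f} & {in A, forall x, f x \in B}.
Proof.
case/card_gt0P=> y0 _ leAB.
have ltB x : x \in A -> index x (enum A) < size (enum B).
  by move=> xA; rewrite -cardE (leq_trans _ leAB) // [#|A|]cardE index_mem mem_enum.
exists (fun x => nth y0 (enum B) (index x (enum A))) => [x y xA yA|x xA].
  move/eqP; rewrite nth_uniq ?enum_uniq ?ltB // => /eqP eqi.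
  have mA z : z \in A -> z \in enum A by rewrite mem_enum.
  by rewrite -(nth_index x (mA x xA)) eqi nth_index ?mA.
by rewrite -mem_enum mem_nth ?ltB.
Qed.

(** Any injection between the sides extends along the two matchings. *)
Lemma crown_isomorphic (G H : sgraph) (s : G -> bool) (p : G -> G)
    (t : H -> bool) (q : H -> H) :
  crown s p -> crown t q -> 0 < #|G| -> #|G| = #|H| -> isomorphic G H.
Proof.
move=> crG crH G0 eqGH.
have /double_inj eqst : #|[set x | s x]|.*2 = #|[set x | t x]|.*2.
  by rewrite -(crown_card crG) -(crown_card crH).
have t0 : 0 < #|[set x | t x]|.
  by rewrite -double_gt0 -(crown_card crH) -eqGH.
have [|g g_inj gB] := @leq_card_injection G H [set x | s x] [set x | t x] t0.
  by rewrite eqst.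
case: crG crH => pK sp eG [qK tq eH].
have gt x : s x -> t (g x) by move=> sx; have := gB x; rewrite !inE; apply.
pose f x := if s x then g x else q (g (p x)).
have tf x : t (f x) = s x.
  rewrite /f; case sx: (s x); first exact: gt.
  by rewrite tq gt // sp sx.
have fp x : f (p x) = q (f x).
  by rewrite /f sp; case: (s x) => /=; rewrite ?pK // qK.
have f_inj : injective f.
  move=> x y fxy; have sxy : s x = s y by rewrite -!tf fxy.
  have spn z : s z = false -> s (p z) by rewrite sp => ->.
  move: fxy; rewrite /f -sxy; case sx: (s x) (sxy) => /esym sy.
    by apply: g_inj; rewrite inE.
  move/(inv_inj qK)=> gxy; apply: (inv_inj pK).
  by apply: g_inj gxy; rewrite inE spn.
exists f; first by apply: inj_card_bij => //; rewrite eqGH.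
by move=> x y; rewrite eG eH !tf -fp (inj_eq f_inj).
Qed.

Definition K0_side (x : K0) : bool := if x is inl _ then true else false.

Definition K0_match (x : K0) : K0 :=
  match x with inl i => inr i | inr i => inl i end.

Lemma K0_crown : crown K0_side K0_match.
Proof.
split; [by case | by case |].
by case=> i [] j //=; rewrite 1?eq_sym.
Qed.

Definition K_side (k : nat) (x : K k) : bool :=
  match x with inl (inl _) | inr (inr _) => true | _ => false end.

Definition K_match (k : nat) (x : K k) : K k :=
  match x with
  | inl (inl i) => inl (inr i) | inl (inr i) => inl (inl i)
  | inr (inl i) => inr (inr i) | inr (inr i) => inr (inl i)
  end.

Lemma K_crown (k : nat) : crown (@K_side k) (@K_match k).
Proof.
split; [by case=> [] [] | by case=> [] [] |].
by case=> [] [] i [] [] j //=; rewrite 1?eq_sym.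
Qed.

Lemma card_K0 : #|K0| = 4.*2.
Proof. by rewrite card_sum !card_ord. Qed.

Lemma card_K (k : nat) : #|K k| = (4 + k).*2.
Proof. by rewrite !card_sum !card_ord !addnn -doubleD. Qed.

Lemma C4_paired : paired C4.
Proof.
move=> x; exists (inord ((x + 2) %% 4) : C4).
have e4 : (x + 2) %% 4 < 4 by rewrite ltn_mod.
apply/partnerP; split; rewrite -?val_eqE /= /C4_rel ?inordK //.
- by case: x {e4} => -[|[|[|[|]]]].
- by case: x {e4} => -[|[|[|[|]]]].
- move=> z; rewrite -!val_eqE /= inordK //.
  by case: x {e4} => -[|[|[|[|//]]]] ?; case: z => -[|[|[|[|//]]]].
Qed.

(** * Squares and triangles *)

Definition triangle_free (G : sgraph) : Prop :=
  forall x y z : G, sedge x y -> sedge y z -> sedge x z -> False.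

Definition square (G : sgraph) (a b c d : G) : Prop :=
  [/\ a != c, b != d & [/\ sedge a b, sedge b c, sedge c d & sedge d a]].

Lemma square_rot (G : sgraph) (a b c d : G) : square a b c d -> square b c d a.
Proof. by case=> ac bd [*]; split=> //; rewrite eq_sym. Qed.

Lemma sedge_neq (G : sgraph) (x y : G) : sedge x y -> x != y.
Proof. by apply: contraTneq => ->; rewrite sedge_irr. Qed.

Lemma girth4_triangle_free (G : sgraph) : is_girth G 4 -> triangle_free G.
Proof.
case=> _ min x y z xy yz xz.
suff : simple_cycle [:: x; y; z] by move/min.
rewrite /simple_cycle /= xy yz sedge_sym xz !inE.
by rewrite negb_or !sedge_neq.
Qed.

Lemma girth4_square (G : sgraph) :
  is_girth G 4 -> exists a b c d : G, square a b c d.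
Proof.
case=> -[[|a [|b [|c [|d []]]]] //= /and3P[cyc uc _] _ _].
exists a, b, c, d; move: cyc uc => /= /and5P[ab bc cd da _].
rewrite !inE !negb_or => /andP[/and3P[_ ac _] /andP[/andP[_ bd] _]].
by split.
Qed.

(** Some edge of the square avoids [x] and would form a triangle with it. *)
Lemma no_universal_vertex (G : sgraph) (a b c d x : G) :
  triangle_free G -> square a b c d -> ~~ dominating [set x].
Proof.
move=> tf [ac bd [ab bc cd da]]; apply/dominating1P=> univ.
case: (eqVneq a x) => [ax|ax].
  by apply: (tf a b c) => //; rewrite ax; apply: univ; rewrite -ax eq_sym.
case: (eqVneq b x) => [bx|bx].
  by apply: (tf b c d) => //; rewrite bx; apply: univ; rewrite -bx eq_sym.
by apply: (tf x a b) => //; apply: univ.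
Qed.

(** * Classification *)

Lemma square_C4 (G : sgraph) (a b c d : G) :
  triangle_free G -> square a b c d -> (forall z, z \in [:: a; b; c; d]) ->
  isomorphic G C4.
Proof.
move=> tf [ac bd [ab bc cd da]] all4; apply: isomorphic_sym.
have nac : sedge a c = false by apply/negP=> /(tf a b c ab bc).
have nbd : sedge b d = false by apply/negP=> /(tf b c d bc cd).
have uniq4 : uniq [:: a; b; c; d].
  by rewrite /= !inE !negb_or ac bd (eq_sym a d) !sedge_neq.
exists (fun i : C4 => nth a [:: a; b; c; d] i).
  apply: inj_card_bij => [i j /eqP|].
    by rewrite nth_uniq // => /eqP/val_inj.
  rewrite card_ord; apply: leq_trans (card_size [:: a; b; c; d]).
  by apply/subset_leq_card/subsetP => z _; apply: all4.
case=> -[|[|[|[|//]]]] ? [[|[|[|[|//]]]] ?] /=;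
  by rewrite /C4_rel /= ?sedge_irr ?nac ?nbd ?ab ?bc ?cd ?da //
    sedge_sym ?nac ?nbd ?ab ?bc ?cd ?da.
Qed.

(** In a triangle-free graph the hypotheses on [v], [w], [c] and [a] say that
    [G] is the 5-cycle [a v c w b] with [b] replaced by a possibly empty set of
    twins, namely the vertices other than [a], [v], [c], [w].  Two twins [b],
    [b'] cannot coexist: a partner of [b] would have to be [b'] itself, as no
    vertex nonadjacent to [b] is adjacent to [b'], and then neither of them is
    adjacent to [v].  So [G] is a path or a 5-cycle. *)
Lemma five_cycle_no_square (G : sgraph) (v w c a : G) (y1 y2 y3 y4 : G) :
  triangle_free G -> paired G ->
  (forall z, sedge c z -> z \in [:: v; w]) ->
  (forall z, z \notin [:: v; w; c; a] -> sedge a z && sedge w z) ->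
  sedge v a -> sedge v c -> sedge w c -> ~~ sedge w a -> ~~ sedge v w ->
  square y1 y2 y3 y4 -> False.
Proof.
move=> tf pG Nc twin va vc wc nwa nvw.
have sym := @sedge_sym G; have ne := @sedge_neq G.
have nva b : sedge a b -> ~~ sedge v b.
  by move=> ab; apply/negP=> vb; apply: (tf v a b).
have twin1 b b' : b \notin [:: v; w; c; a] -> b' \notin [:: v; w; c; a] ->
    b = b'.
  move=> bB b'B; apply/eqP/negPn/negP=> bb'.
  have /andP[ab wb] := twin b bB; have /andP[ab' wb'] := twin b' b'B.
  have [x /partnerP[bx nbx dom]] := pG b.
  have nbb' : ~~ sedge b b' by apply/negP=> /(tf a b b' ab); apply.
  have xE : x = b'.
    apply/eqP; case: eqVneq => // xb'.
    have b'x : sedge b' x.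
      have : sedge b b' || sedge x b' by apply: dom; rewrite eq_sym.
      by rewrite (negPf nbb') sym.
    have : b' \in [:: v; w] \/ x \in [:: v; w; c; a].
      case: (boolP (x \in _)) => [|/twin/andP[ax _]]; first by right.
      by case: (tf a b' x).
    case=> [b'vw|]; first by move: b'B; rewrite !inE in b'vw *; rewrite !negb_or;
      case/orP: b'vw => /eqP->; rewrite eqxx ?andbF.
    rewrite !inE => /or4P[]/eqP xE; rewrite xE in nbx b'x.
    - by rewrite sym (negPf (nva _ ab')) in b'x.
    - by rewrite sym wb in nbx.
    - rewrite sym in b'x; move/Nc: b'x b'B; rewrite !inE !negb_or.
      by case/orP=> ->; rewrite ?andbF.
    - by rewrite sym ab in nbx.
  have vB z : z \notin [:: v; w; c; a] -> v != z.
    by rewrite !inE negb_or eq_sym => /andP[].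
  have := dom v (vB b bB); rewrite xE => /(_ (vB b' b'B)).
  by rewrite ![sedge _ v]sym !(negPf (nva _ _)).
have Nv z : sedge v z -> z \in [:: c; a].
  move=> vz; case: (boolP (z \in [:: v; w; c; a])) => [|/twin/andP[/nva]].
    rewrite !inE => /or4P[]/eqP zE; rewrite zE ?eqxx ?orbT //.
      by rewrite zE sedge_irr in vz.
    by rewrite zE (negPf nvw) in vz.
  by rewrite vz.
have Nw z : sedge w z -> z = c \/ z \notin [:: v; w; c; a].
  move=> wz; case: (boolP (z \in [:: v; w; c; a])) => [|]; last by right.
  rewrite !inE => /or4P[]/eqP zE; last 1 first.
  - by rewrite zE (negPf nwa) in wz.
  - by rewrite zE sym (negPf nvw) in wz.
  - by rewrite zE sedge_irr in wz.
  - by left.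
(* A square has only [a] and one twin left once [c], [v] and [w] are excluded:
   [c] because [v] and [w] have no other common neighbour, then [v] because its
   neighbours are [c] and [a], then [w] because its neighbours are [c] and the
   twin. *)
have no_c z2 z3 z4 : ~ square c z2 z3 z4.
  case=> cz3 z24 [/Nc z2E z23 z34]; rewrite sym => /Nc z4E.
  have [vz3 wz3] : sedge v z3 /\ sedge w z3.
    rewrite sym in z34; move: z24 z23 z34; move: z2E z4E.
    by rewrite !inE => /orP[]/eqP-> /orP[]/eqP->; rewrite ?eqxx.
  have := Nv _ vz3; rewrite !inE eq_sym (negPf cz3) /= => /eqP z3a.
  by rewrite z3a (negPf nwa) in wz3.
have no_v z2 z3 z4 : ~ square v z2 z3 z4.
  move=> sq; case: (sq) => _ z24 [/Nv + _ _]; rewrite sym => + /Nv.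
  rewrite !inE => /orP[]/eqP z2E /orP[]/eqP z4E; subst z2 z4.
  - by rewrite eqxx in z24.
  - exact: no_c (square_rot sq).
  - exact: no_c (square_rot (square_rot (square_rot sq))).
  - by rewrite eqxx in z24.
have no_w z2 z3 z4 : ~ square w z2 z3 z4.
  move=> sq; case: (sq) => _ z24 [/Nw + _ _]; rewrite sym => + /Nw.
  case=> [z2E|z2B] [z4E|z4B]; try subst z2; try subst z4.
  - by rewrite eqxx in z24.
  - exact: no_c (square_rot sq).
  - exact: no_c (square_rot (square_rot (square_rot sq))).
  - by rewrite (twin1 _ _ z2B z4B) eqxx in z24.
have on_square z1 z2 z3 z4 : square z1 z2 z3 z4 ->
    z1 = a \/ z1 \notin [:: v; w; c; a].
  move=> sq; case: (boolP (z1 \in [:: v; w; c; a])) => [|]; last by right.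
  rewrite !inE => /or4P[]/eqP zE; subst z1; last by left.
  - by case: (no_v _ _ _ sq).
  - by case: (no_w _ _ _ sq).
  - by case: (no_c _ _ _ sq).
move=> sq; have sq2 := square_rot sq; have sq3 := square_rot sq2.
case: (sq) => y13 y24 [y12 y23 _ _].
case: (on_square _ _ _ _ sq2) => [y2a|y2B].
  case: (on_square _ _ _ _ sq) => [y1a|y1B].
    by rewrite y1a y2a sedge_irr in y12.
  case: (on_square _ _ _ _ sq3) => [y3a|y3B].
    by rewrite y3a y2a sedge_irr in y23.
  by rewrite (twin1 _ _ y1B y3B) eqxx in y13.
case: (on_square _ _ _ _ sq) => [y1a|y1B].
  case: (on_square _ _ _ _ sq3) => [y3a|y3B].
    by rewrite y1a y3a eqxx in y13.
  by rewrite (twin1 _ _ y2B y3B) sedge_irr in y23.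
by rewrite (twin1 _ _ y1B y2B) sedge_irr in y12.
Qed.

(** Every vertex other than [v], [w], [c] and the partner [a] of [c] is adjacent
    to [a], and, as there are no triangles, to at most one of [v], [w]: if [a]
    is adjacent to both, no such vertex exists, and if [a] is adjacent to [v]
    alone, they are all adjacent to [w]. *)
Lemma common_neighbour_C4 (G : sgraph) (v w c : G) (y1 y2 y3 y4 : G) :
  triangle_free G -> paired G -> square y1 y2 y3 y4 ->
  partner v w -> sedge v c -> sedge w c -> isomorphic G C4.
Proof.
move=> tf pG sq pvw vc wc; have sym := @sedge_sym G.
case/partnerP: (pvw) => vw nvw domvw.
have Nc z : sedge c z -> z \in [:: v; w].
  move=> cz; rewrite !inE; apply/norP=> -[zv zw].
  have /orP[vz|wz] := domvw z zv zw; first exact: (tf v c z).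
  exact: (tf w c z).
have [a /partnerP[ca nca domc]] := pG c.
have adja z : z != v -> z != w -> z != c -> z != a -> sedge a z.
  move=> zv zw zc za; have /orP[/Nc|//] := domc z zc za.
  by rewrite !inE (negPf zv) (negPf zw).
have av : a != v by apply: contraNneq nca => ->; rewrite sym.
have aw : a != w by apply: contraNneq nca => ->; rewrite sym.
case va: (sedge v a); case wa: (sedge w a).
- apply: (@square_C4 G v c w a tf) => [|z].
    by split=> //; split; rewrite // sym.
  rewrite !inE; apply/negPn/negP; rewrite !negb_or => /and4P[zv zc zw za].
  have az := adja z zv zw zc za.
  by have /orP[vz|wz] := domvw z zv zw; [apply: (tf v a z)|apply: (tf w a z)].
- exfalso; apply: (@five_cycle_no_square G v w c a y1 y2 y3 y4) => //.
    move=> z; rewrite !inE !negb_or => /and4P[zv zw zc za].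
    have az := adja z zv zw zc za; rewrite az /=.
    by have /orP[vz|//] := domvw z zv zw; case: (tf v a z).
  by rewrite wa.
- exfalso; apply: (@five_cycle_no_square G w v c a y1 y2 y3 y4) => //.
  + by move=> z /Nc; rewrite !inE orbC.
  + move=> z; rewrite !inE !negb_or => /and4P[zw zv zc za].
    have az := adja z zv zw zc za; rewrite az /=.
    by have /orP[//|wz] := domvw z zv zw; case: (tf w a z).
  + by rewrite va.
  + by rewrite sym.
- by have := domvw a av aw; rewrite va wa.
Qed.

(** For any pair of partners [v0], [w0], the side [s] consists of [v0] and the
    neighbours of [w0].  The square is used to see that partners lie on
    opposite sides: each side contains two opposite vertices of it, and partners
    on the same side would be the only vertices there, hence those two, which
    have a common neighbour. *)
Lemma disjoint_crown (G : sgraph) (y1 y2 y3 y4 : G) :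
  triangle_free G -> paired G -> square y1 y2 y3 y4 ->
  (forall v w c : G, partner v w -> sedge v c -> sedge w c -> False) ->
  exists (s : G -> bool) (p : G -> G), crown s p.
Proof.
move=> tf pG [y13 y24 [y12 y23 y34 y41]] disj; have sym := @sedge_sym G.
have [w0 pvw] := pG y1; set v0 := y1 in pvw.
case/partnerP: (pvw) => vw nvw domvw.
pose s x := (x == v0) || sedge w0 x.
have nsP x : s x = false -> x = w0 \/ sedge v0 x.
  case/norP=> xv nwx; case: (eqVneq x w0) => xw; first by left.
  by right; have := domvw x xv xw; rewrite (negPf nwx) orbF.
have indep x y : sedge x y -> s y = ~~ s x.
  move=> xy; case sx: (s x); case sy: (s y) => //=; exfalso.
    case/orP: sx sy => [/eqP xv|wx] /orP[/eqP yv|wy].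
    - by rewrite xv yv sedge_irr in xy.
    - by rewrite xv in xy; apply: disj pvw xy wy.
    - by rewrite yv sym in xy; apply: disj pvw xy wx.
    - exact: (tf w0 x y).
  case: (nsP _ sx) (nsP _ sy) => [xw|vx] [yw|vy].
  - by rewrite xw yw sedge_irr in xy.
  - by rewrite xw in xy; apply: disj pvw vy xy.
  - by rewrite yw sym in xy; apply: disj pvw vx xy.
  - exact: (tf v0 x y).
have opposite x y : partner x y -> s y = ~~ s x.
  move=> pxy; case/partnerP: (pxy) => xy nxy dom.
  apply/eqP/negPn/negP=> same.
  have {}same : s y = s x by case: (s y) (s x) same => [] [].
  (* [x] and [y] are the only vertices of their side. *)
  have only z : s z = s x -> z \in [:: x; y].
    move=> zx; rewrite !inE; apply/norP=> -[z_x z_y].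
    have /orP[/indep|/indep] := dom z z_x z_y; rewrite zx ?same;
      by case: (s x).
  have clash a b c : a != c -> sedge a b -> sedge b c -> s a = s x -> False.
    move=> ac ab bc sa; have sc : s c = s x.
      by rewrite (indep _ _ bc) (indep _ _ ab) negbK.
    have := only _ sc; have := only _ sa; rewrite !inE.
    rewrite sym in bc.
    case/orP=> /eqP aE /orP[]/eqP cE; subst a c.
    - by rewrite eqxx in ac.
    - exact: disj pxy ab bc.
    - exact: disj pxy bc ab.
    - by rewrite eqxx in ac.
  case: (eqVneq (s y1) (s x)) => [|y1x]; first exact: (clash y1 y2 y3).
  apply: (clash y2 y3 y4) => //; rewrite (indep _ _ y12).
  by case: (s y1) (s x) y1x => [] [].
have ex x : exists y, partner x y := pG x.
pose p x := xchoose (ex x).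
have pP x : partner x (p x) := xchooseP (ex x).
have sp x : s (p x) = ~~ s x by apply: opposite.
have eE x y : sedge x y = (s x != s y) && (y != p x).
  have /partnerP[_ nxp dom] := pP x.
  apply/idP/andP=> [xy|[sxy yp]].
    rewrite (indep _ _ xy); split; first by case: (s x).
    by apply: contraTneq xy => ->.
  have yx : y != x by apply: contraNneq sxy => ->.
  have /orP[//|/indep] := dom y yx yp.
  by rewrite sp => sy; move: sxy; rewrite sy negbK eqxx.
exists s, p; split=> // x.
have := eE (p x) x; rewrite sp sym; have /partnerP[_ /negPf-> _] := pP x.
by case: (eqVneq x (p (p x))) => [<- //|]; case: (s x).
Qed.

(** If [a], [c] are opposite vertices of a square, and [b], [d] the other two,
    then [a], [c], [p b], [p d] are distinct vertices on the same side. *)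
Lemma crown_square_card (G : sgraph) (s : G -> bool) (p : G -> G)
    (a b c d : G) :
  crown s p -> square a b c d -> 4 <= #|[set x | s x]|.
Proof.
move=> cr; wlog sa : a b c d / s a => [W sq|].
  case sa: (s a); first exact: W sq.
  apply: (W b c d a); last exact: square_rot.
  by case: cr sq => _ _ eE [_ _ [+ _ _ _]]; rewrite eE sa; case: (s b).
case: cr => pK sp eE [ac bd []]; rewrite !eE sa.
case/andP=> sb bpa /andP[sc cpb] /andP[sd dpc] /andP[_ apd].
have {}sb : s b = false by case: (s b) sb.
have {}sc : s c by move: sc; rewrite sb; case: (s c).
have {}sd : s d = false by move: sd; rewrite sc; case: (s d).
have uniq4 : uniq [:: a; c; p b; p d].
  rewrite /= !inE !negb_or ac apd cpb (inj_eq (inv_inj pK)) bd !andbT /=.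
  apply/andP; split; first by rewrite -(inj_eq (inv_inj pK)) pK eq_sym.
  by rewrite -(inj_eq (inv_inj pK)) pK eq_sym.
rewrite -[4]/(size [:: a; c; p b; p d]) -(card_uniqP uniq4).
apply/subset_leq_card/subsetP=> x; rewrite !inE.
by case/or4P=> /eqP->; rewrite ?sa ?sc // sp ?sb ?sd.
Qed.

Theorem theorem5p12 (G : sgraph) (n : nat) (order_G : #|G| = n)
    (girth_G : is_girth G 4) :
  is_IC G n <->
  (isomorphic G C4 \/ isomorphic G K0 \/
   exists k : nat, 1 <= k /\ isomorphic G (K k)).
Proof.
have tf := girth4_triangle_free girth_G.
have [a [b [c [d sq]]]] := girth4_square girth_G.
rewrite -order_G; split=> [/is_IC_orderP univ_or_partner | iso]; last first.
  apply/is_IC_orderP=> x; right; move: x; rewrite -/(paired G).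
  case: iso => [/isomorphic_paired|[/isomorphic_paired|[k [_ /isomorphic_paired]]]];
    apply; [exact: C4_paired | exact: crown_paired K0_crown |
            exact: crown_paired (K_crown k)].
have pG : paired G.
  move=> x; case: (univ_or_partner x) => //.
  by rewrite (negPf (no_universal_vertex x tf sq)).
case: (boolP [exists v : G, exists w, exists z,
    [&& partner v w, sedge v z & sedge w z]]).
  case/existsP=> v /existsP[w /existsP[z /and3P[pvw vz wz]]].
  by left; apply: common_neighbour_C4 sq pvw vz wz.
move=> no_common; right.
have [s [p cr]] : exists (s : G -> bool) (p : G -> G), crown s p.
  apply: disjoint_crown sq _ => // v w z pvw vz wz; case/negP: no_common.
  apply/existsP; exists v; apply/existsP; exists w; apply/existsP; exists z.
  by rewrite pvw vz wz.
have G0 : 0 < #|G| by apply/card_gt0P; exists a.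
have le4 := crown_square_card cr sq; have cG := crown_card cr.
case: (eqVneq #|[set x | s x]| 4) => [eq4|ne4].
  by left; apply: crown_isomorphic cr K0_crown G0 _; rewrite cG eq4 card_K0.
right; exists (#|[set x | s x]| - 4); split.
  by rewrite subn_gt0 ltn_neqAle eq_sym ne4.
by apply: crown_isomorphic cr (@K_crown _) G0 _; rewrite card_K subnKC.
Qed.
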